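(* (The Sine Rule) Let $p\ge 0$ be an integer, and let $\gamma_\alpha=r_\alpha+i\varphi_\alpha$ and $\gamma_\beta=r_\beta+i\varphi_\beta$ be the complex lengths of the singular geodesics of a hyperbolic cone-manifold $W_p(\alpha,\beta)$ with cone angles $\alpha$ and $\beta$ respectively. Then $$\frac{\sin\frac{\varphi_\alpha}{2}}{\sinh\frac{r_\alpha}{2}}=\frac{\sin\frac{\varphi_\beta}{2}}{\sinh\frac{r_\beta}{2}}.$$
   Context: A 3-dimensional hyperbolic cone-manifold is a Riemannian 3-manifold of constant sectional curvature $-1$ with cone-type singularities along simple closed geodesics, each singular component having a cone angle. For an integer $p\ge 0$, the twist link $W_p$ is the two-component two-bridge link in $S^3$ with slope $(4p+4)/(2p+1)$. $W_p(\alpha,\beta)$ is the cone-manifold with underlying space $S^3$ and singular set $W_p=\Sigma^1\cup\Sigma^2$, with cone angle $\alpha$ along $\Sigma^1$ and $\beta$ along $\Sigma^2$, where $0<\alpha,\beta\le\pi$. The fundamental group of $S^3\setminus W_p$ is $\Phi_p=\langle s,t\mid s l_s=l_s s\rangle=\langle s,t\mid t l_t=l_t t\rangle$, where $s,t$ are meridians of $\Sigma^1,\Sigma^2$ and $l_s,l_t$ the corresponding longitudes. With $[x,y]=xyx^{-1}y^{-1}$, $$l_s=[s,t]^{\frac{p+1}{2}}[s,t^{-1}]^{\frac{p+1}{2}}\ (p\text{ odd}),\qquad l_s=s^{-1}[t,s]^{\frac p2}\,tst\,[s^{-1},t^{-1}]^{\frac p2}\ (p\text{ even}),$$ and $l_t$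 is obtained by exchanging $s$ and $t$. If $W_p(\alpha,\beta)$ is hyperbolic, its holonomy homomorphism lifts to $h=h_{\alpha,\beta}:\Phi_p\to SL(2,\mathbf C)$, where $S=h(s)$ and $T=h(t)$ satisfy $\mathrm{tr}(S)=2\cos\frac\alpha2$, $\mathrm{tr}(T)=2\cos\frac\beta2$. Put $L_S=h(l_s)$, $L_T=h(l_t)$; these are loxodromic. The displacement of an isometry of $\mathbf H^3$ translating by $r$ along its axis and rotating by $\varphi$ about it is the complex number $r+i\varphi$. The complex length $\gamma_\alpha=r_\alpha+i\varphi_\alpha$ (resp. $\gamma_\beta=r_\beta+i\varphi_\beta$) of the singular component with cone angle $\alpha$ (resp. $\beta$) is the displacement of $L_S$ (resp. $L_T$), normalized so that $r_\alpha>0$ and $\cosh\frac{\gamma_\alpha}{2}=-\frac12\mathrm{tr}(L_S)$ (resp. $r_\beta>0$ and $\cosh\frac{\gamma_\beta}{2}=-\frac12\mathrm{tr}(L_T)$). Thus the eigenvalue of $L_S$ of modulus $>1$ is $-e^{\gamma_\alpha/2}$, and similarly for $L_T$. *)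

(* Defs.v *)
From HB Require Import structures.
From mathcomp Require Import all_boot all_order all_algebra.
From mathcomp Require Import reals sequences exp trigo.
From mathcomp Require Import complex.

Set Implicit Arguments.
Unset Strict Implicit.
Unset Printing Implicit Defensive.

Import Order.TTheory GRing.Theory Num.Theory.

Local Open Scope ring_scope.
Local Open Scope complex_scope.

Definition sinhR (R : realType) (x : R) : R := (expR x - expR (- x)) / 2.

Definition cexp (R : realType) (z : R[i]) : R[i] :=
  (expR (complex.Re z))%:C * (cos (complex.Im z) +i* sin (complex.Im z)).

Definition ccosh (R : realType) (z : R[i]) : R[i] := (cexp z + cexp (- z)) / 2.

(* Group words are evaluated in the unit group of a unit ring, which is applied
   below to 2 x 2 matrices of determinant 1. *)
Definition commutator (U : unitRingType) (x y : U) : U := x * y * x^-1 * y^-1.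

(* [longitude p s t] is the word l_s; exchanging the two letters,
   [longitude p t s] is the word l_t. *)
Definition longitude (U : unitRingType) (p : nat) (s t : U) : U :=
  if odd p then
    commutator s t ^+ (p.+1)./2 * commutator s t^-1 ^+ (p.+1)./2
  else
    s^-1 * commutator t s ^+ p./2 * (t * s * t) * commutator s^-1 t^-1 ^+ p./2.

(* A homomorphism h from
     Phi_p = < s, t | s l_s = l_s s > = < s, t | t l_t = l_t t >
   to SL(2, C) is the same thing as the pair S = h s, T = h t of matrices of
   determinant 1 satisfying the defining relation; since both presentations
   define the same group, both relations hold for it. The trace conditions are those which the
   cone angles alpha and beta of W_p(alpha, beta) impose on the lifted
   holonomies of the meridians. Neither discreteness nor the existence of a
   developing map is required: the holonomy of a hyperbolic W_p(alpha, beta) is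
   an instance of this record, but not every instance need be of that kind. *)
Record cone_holonomy (R : realType) (p : nat) (alpha beta : R)
    (S T : 'M[R[i]]_2) : Prop := ConeHolonomy {
  cone_detS : \det S = 1;
  cone_detT : \det T = 1;
  cone_relS : S * longitude p S T = longitude p S T * S;
  cone_relT : T * longitude p T S = longitude p T S * T;
  cone_trS : \tr S = (2 * cos (alpha / 2))%:C;
  cone_trT : \tr T = (2 * cos (beta / 2))%:C
}.

(* In the upper half-space model, the translation by r along the axis from 0 to
   infinity followed by the rotation by phi about it acts on the boundary as
   z |-> e^(r + i phi) z. *)
Definition axial_mx (R : realType) (r phi : R) : 'M[R[i]]_2 :=
  \matrix_(i, j) if i == j
    then cexp ((if i == 0 then 1 else -1) * ((r +i* phi) / 2)) else 0.

(* The isometry of hyperbolic 3-space defined by [g] in SL(2, C), that is, by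
   [g] up to sign, has displacement r + i phi. This leaves r + i phi determined
   only up to its sign and modulo 2 pi i. *)
Definition displacement (R : realType) (g : 'M[R[i]]_2) (r phi : R) : Prop :=
  exists2 P : 'M[R[i]]_2, P \is a GRing.unit &
    g = P * axial_mx r phi * P^-1 \/ g = - (P * axial_mx r phi * P^-1).

(* The displacement of a longitude, with its sign fixed by r > 0 and phi
   determined modulo 4 pi by the last condition, which makes the eigenvalue of
   modulus > 1 of [L] equal to - e^((r + i phi) / 2). *)
Definition complex_length (R : realType) (L : 'M[R[i]]_2) (r phi : R) : Prop :=
  [/\ displacement L r phi,
      0 < r &
      ccosh ((r +i* phi) / 2) = - (\tr L / 2)].

(* Main.v *)
(* Up to conjugation by s, which commutes with l_s, the element l_s t^-1 is
   conjugate to t or t^-1, whence tr (L_S T^-1) = tr T. As L_S commutes with the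
   non-scalar S, it has the form a S + b; with x = tr S, y = tr T and
   k = 2 tr (S T^-1) - x y, the traces of L_S and L_S T^-1 give
   a k = y (2 - tr L_S), while det L_S = 1 gives
   (tr L_S)^2 - 4 = a^2 (x^2 - 4). The number k is symmetric in S and T and does
   not vanish: otherwise x = y = k = 0, so that S and T generate a quaternion
   group, in which L_S = 1 or -1. Eliminating a and k,
     (tr L_S + 2) / (tr L_S - 2) = tanh^2 (gamma_alpha / 4)
   and its analogue for beta have the positive ratio y^2 (4 - x^2) to
   x^2 (4 - y^2). Since tanh (gamma / 4) is a positive multiple of
   sinh (r / 2) + i sin (phi / 2), comparing arguments gives the Sine Rule. *)

Require Import Defs.
From HB Require Import structures.
From mathcomp Require Import all_boot all_order all_algebra.
From mathcomp Require Import reals sequences exp trigo.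
From mathcomp Require Import complex.
From mathcomp Require Import ring lra.

Set Implicit Arguments.
Unset Strict Implicit.
Unset Printing Implicit Defensive.

Import Order.TTheory GRing.Theory Num.Theory.

Local Open Scope ring_scope.
Local Open Scope complex_scope.

(** * Group words: a longitude times the inverse of the other meridian *)

Lemma exprJ (U : unitRingType) (a b : U) n : a \is a GRing.unit ->
  (a^-1 * b * a) ^+ n = a^-1 * b ^+ n * a.
Proof.
move=> ua; elim: n => [|n IHn]; first by rewrite !expr0 mulr1 mulVr.
by rewrite exprS IHn exprS !mulrA mulrK.
Qed.

Lemma unitr_commutator (U : unitRingType) (s t : U) :
  s \is a GRing.unit -> t \is a GRing.unit ->
  commutator s t \is a GRing.unit.
Proof. by move=> us ut; rewrite /commutator !rpredM // rpredV. Qed.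

Lemma commutatorV (U : unitRingType) (s t : U) :
  s \is a GRing.unit -> t \is a GRing.unit ->
  (commutator s t)^-1 = commutator t s.
Proof.
move=> us ut; rewrite /commutator.
by rewrite !invrM ?rpredM ?rpredV // !invrK !mulrA.
Qed.

(** Conjugation by [t] turns [[s, t^-1]] into [[t, s] = [s, t]^-1], so with [w = [s, t]^((p+1)/2)]
    the longitude is [w t^-1 w^-1 t]. *)
Lemma longitude_odd (U : unitRingType) p (s t : U) :
  s \is a GRing.unit -> t \is a GRing.unit -> odd p ->
  exists2 w : U, w \is a GRing.unit & longitude p s t / t = w * t^-1 / w.
Proof.
move=> us ut op; exists (commutator s t ^+ (p.+1)./2).
  by rewrite unitrX ?unitr_commutator.
have -> : longitude p s t = commutator s t ^+ (p.+1)./2 *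
    commutator s t^-1 ^+ (p.+1)./2 by rewrite /longitude op.
have -> : commutator s t^-1 = t^-1 * commutator t s * t.
  by rewrite /commutator invrK !mulrA mulVr // mul1r.
by rewrite exprJ // -[commutator t s]commutatorV // exprVn !mulrA mulrK.
Qed.

(** Here [[s^-1, t^-1]] is a conjugate of [[t, s]^-1] by [t s], so the two powers become [w] and a
    conjugate of [w^-1]. Conjugating the longitude by [s] removes its leading [s^-1]; what remains
    inside, [t s t s^-1 t^-1], is a conjugate of [t]. *)
Lemma longitude_even (U : unitRingType) p (s t : U) :
  s \is a GRing.unit -> t \is a GRing.unit -> ~~ odd p ->
  exists2 w : U, w \is a GRing.unit &
    s * longitude p s t / s / t = w * (t * s * t / s / t) / w.
Proof.
move=> us ut op; exists (commutator t s ^+ p./2).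
  by rewrite unitrX ?unitr_commutator.
have -> : longitude p s t = s^-1 * commutator t s ^+ p./2 * (t * s * t) *
    commutator s^-1 t^-1 ^+ p./2 by rewrite /longitude (negPf op).
have uts : t * s \is a GRing.unit by rewrite rpredM.
have -> : commutator s^-1 t^-1 = (t * s)^-1 * commutator s t * (t * s).
  rewrite /commutator !invrK invrM // !mulrA.
  by rewrite mulrVK ?mulrK // mulrVK.
rewrite exprJ // -[commutator s t]commutatorV // exprVn invrM // !mulrA.
by rewrite divrr // mul1r !mulrK.
Qed.

(** * Trace identities for longitudes in SL(2) *)

Section Matrix2.
Variable F : numFieldType.
Implicit Types A B S T L W : 'M[F]_2.

Lemma det_mx2 A : \det A = A 0 0 * A 1 1 - A 0 1 * A 1 0.
Proof.
rewrite (expand_det_row _ 0) !big_ord_recl big_ord0 addr0 /cofactor !det_mx11.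
rewrite !mxE /= expr0 expr1 mul1r mulN1r mulrN.
by congr (_ * A _ _ - A _ _ * A _ _); apply/val_inj.
Qed.

Lemma mxtrace2 A : \tr A = A 0 0 + A 1 1.
Proof.
rewrite /mxtrace !big_ord_recl big_ord0 addr0.
by congr (_ + A _ _); apply/val_inj.
Qed.

Lemma mulmx2E A B i j : (A * B) i j = A i 0 * B 0 j + A i 1 * B 1 j.
Proof.
have -> : (A * B) i j = \sum_k A i k * B k j by exact: mxE.
rewrite !big_ord_recl big_ord0 addr0.
by congr (_ + A _ _ * B _ _); apply/val_inj.
Qed.

Lemma eq_mx2 A B : A 0 0 = B 0 0 -> A 0 1 = B 0 1 -> A 1 0 = B 1 0 ->
  A 1 1 = B 1 1 -> A = B.
Proof.
move=> e00 e01 e10 e11; apply/matrixP => i j.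
have ord2 (k : 'I_2) : k = 0 \/ k = 1.
  by case: k => [[|[|k]] ltk2] //; [left|right]; apply/val_inj.
by case: (ord2 i) => ->; case: (ord2 j) => ->.
Qed.

Lemma unitmx_det1 A : \det A = 1 -> A \is a GRing.unit.
Proof. by move=> dA; rewrite -[_ \is a _]/(A \in unitmx) unitmxE dA unitr1. Qed.

(** Cayley-Hamilton in determinant 1, checked entry by entry. *)
Lemma invmx_det1 A : \det A = 1 -> A^-1 = (\tr A)%:M - A.
Proof.
move=> dA; have uA := unitmx_det1 dA.
apply: (mulrI uA); rewrite divrr //; move: dA; rewrite det_mx2 => dA.
apply/esym; apply: eq_mx2;
  rewrite mulmx2E !mxE mxtrace2 /= ?(mulr1n, mulr0n) -1?dA; ring.
Qed.

Lemma mxtrace_conj W A : W \is a GRing.unit -> \tr (W * A / W) = \tr A.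
Proof. by move=> uW; rewrite mxtrace_mulC -[_ *m _]/(W^-1 * (W * A)) mulKr. Qed.

Lemma det_inv_det1 A : \det A = 1 -> \det (A^-1) = 1.
Proof. by move=> dA; rewrite -[A^-1]/(invmx A) det_inv dA invr1. Qed.

Lemma mxtrace_inv_det1 A : \det A = 1 -> \tr A^-1 = \tr A.
Proof.
move=> dA; rewrite invmx_det1 // raddfB /= mxtrace_scalar mulr2n.
exact: addrK.
Qed.

Lemma detMr A B : \det (A * B) = \det A * \det B.
Proof. exact: det_mulmx. Qed.

Lemma detXr A n : \det (A ^+ n) = \det A ^+ n.
Proof.
elim: n => [|n IHn]; first by rewrite !expr0 det1.
by rewrite !exprS detMr IHn.
Qed.

Lemma det_commutator S T : \det S = 1 -> \det T = 1 ->
  \det (commutator S T) = 1.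
Proof. by move=> dS dT; rewrite !detMr !det_inv_det1 // dS dT !mulr1. Qed.

Lemma det_longitude p S T : \det S = 1 -> \det T = 1 ->
  \det (longitude p S T) = 1.
Proof.
move=> dS dT; rewrite /longitude; case: ifP => _;
by rewrite !detMr !detXr !det_commutator ?det_inv_det1 // ?dS ?dT !expr1n !mulr1.
Qed.

Lemma mxtrace_longitude_meridian p S T : \det S = 1 -> \det T = 1 ->
  S * longitude p S T = longitude p S T * S ->
  \tr (longitude p S T / T) = \tr T.
Proof.
move=> dS dT comSL; have [uS uT] := (unitmx_det1 dS, unitmx_det1 dT).
have [op | op] := boolP (odd p).
  have [W uW ->] := longitude_odd uS uT op.
  by rewrite mxtrace_conj // mxtrace_inv_det1.
(* Conjugation by [S] fixes the longitude and brings it to the form treated by [longitude_even]. *)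
have -> : longitude p S T = S * longitude p S T / S by rewrite comSL mulrK.
have [W uW ->] := longitude_even uS uT op.
rewrite mxtrace_conj // -[T * S * T]mulrA -[T * _ / S]mulrA.
by rewrite !mxtrace_conj.
Qed.

(** The characteristic polynomial of [S] has nonzero discriminant [D], so [S] is not scalar, and
    commuting makes the trace-free part of [L] a multiple of that of [S]. *)
Lemma centralizer_mx2 S L : \det S = 1 -> \tr S ^+ 2 != 4 -> S * L = L * S ->
  exists a b, L = a *: S + b%:M.
Proof.
move=> dS trS comSL.
have D0 : (S 0 0 - S 1 1) ^+ 2 + 4 * S 0 1 * S 1 0 != 0.
  apply: contraNneq trS => D0; rewrite -subr_eq0; apply/eqP.
  have -> : \tr S ^+ 2 - 4 = \tr S ^+ 2 - 4 * \det S by rewrite dS mulr1.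
  by rewrite mxtrace2 det_mx2 -[RHS]D0; ring.
have /matrixP/(_ 0 0) := comSL; have /matrixP/(_ 0 1) := comSL.
have /matrixP/(_ 1 0) := comSL; rewrite !mulmx2E => e10 e01 e00.
(* Entries of [S * L - L * S], up to sign for [C10]. *)
pose C00 := S 0 1 * L 1 0 - L 0 1 * S 1 0.
pose C01 := (S 0 0 - S 1 1) * L 0 1 - S 0 1 * (L 0 0 - L 1 1).
pose C10 := (S 0 0 - S 1 1) * L 1 0 - S 1 0 * (L 0 0 - L 1 1).
have c00 : C00 = 0.
  by rewrite -(subrr (S 0 0 * L 0 0 + S 0 1 * L 1 0)) {2}e00 /C00; ring.
have c01 : C01 = 0.
  by rewrite -(subrr (S 0 0 * L 0 1 + S 0 1 * L 1 1)) {2}e01 /C01; ring.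
have c10 : C10 = 0.
  by rewrite -(subrr (L 1 0 * S 0 0 + L 1 1 * S 1 0)) -{2}e10 /C10; ring.
set D := (X in X != 0) in D0.
(* For the trace-free parts [S0] and [L0], this is the projection coefficient
   [tr (S0 L0) / tr (S0^2)], with [D = 2 tr (S0^2)]. *)
pose a := ((S 0 0 - S 1 1) * (L 0 0 - L 1 1)
           + 2 * L 0 1 * S 1 0 + 2 * L 1 0 * S 0 1) / D.
have aD : a * D = (S 0 0 - S 1 1) * (L 0 0 - L 1 1)
           + 2 * L 0 1 * S 1 0 + 2 * L 1 0 * S 0 1 by rewrite divfK.
exists a, (L 0 0 - a * S 0 0); apply: eq_mx2; rewrite !mxE /= ?(mulr1n, mulr0n).
- by ring.
- apply: (mulIf D0); rewrite addr0 mulrAC aD /D; apply: subr0_eq.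
  transitivity ((S 0 0 - S 1 1) * C01 - 2 * S 0 1 * C00).
    by rewrite /C00 /C01; ring.
  by rewrite c00 c01 !mulr0 subr0.
- apply: (mulIf D0); rewrite addr0 mulrAC aD /D; apply: subr0_eq.
  transitivity ((S 0 0 - S 1 1) * C10 + 2 * S 1 0 * C00).
    by rewrite /C00 /C10; ring.
  by rewrite c00 c10 !mulr0 addr0.
- apply: (mulIf D0).
  have -> : (a * S 1 1 + (L 0 0 - a * S 0 0)) * D =
    L 0 0 * D + a * D * (S 1 1 - S 0 0) by ring.
  rewrite aD /D; apply: subr0_eq.
  transitivity (2 * S 1 0 * C01 + 2 * S 0 1 * C10).
    by rewrite /C01 /C10; ring.
  by rewrite c01 c10 !mulr0 addr0.
Qed.

(** With [L = a S + b], eliminating [b] between the traces of [L] and [L T^-1] gives the first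
    equation. The second compares discriminants, which adding the scalar [b] does not change. *)
Lemma longitude_slope p S T : \det S = 1 -> \det T = 1 ->
    \tr S ^+ 2 != 4 -> S * longitude p S T = longitude p S T * S ->
  exists2 a,
    a * (2 * \tr (S / T) - \tr S * \tr T) =
      \tr T * (2 - \tr (longitude p S T)) &
    \tr (longitude p S T) ^+ 2 - 4 = a ^+ 2 * (\tr S ^+ 2 - 4).
Proof.
move=> dS dT trS comSL; have dL := det_longitude p dS dT.
have := mxtrace_longitude_meridian dS dT comSL.
have [a [b eL]] := centralizer_mx2 dS trS comSL.
have trLE : \tr (longitude p S T) = a * \tr S + 2 * b.
  by rewrite eL raddfD /= mxtraceZ mxtrace_scalar mulr_natl.
have dLE : a ^+ 2 + a * b * \tr S + b ^+ 2 = 1.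
  transitivity (a ^+ 2 * \det S + a * b * \tr S + b ^+ 2).
    by rewrite dS mulr1.
  rewrite -dL eL !det_mx2 mxtrace2 !mxE /= ?(mulr1n, mulr0n); ring.
have -> : longitude p S T / T = a *: (S / T) + b *: T^-1.
  by rewrite eL mulrDl -scalemx1 -!scalerAl mul1r.
rewrite raddfD /= !mxtraceZ mxtrace_inv_det1 // => trLT.
exists a; rewrite trLE.
  have -> : a * (2 * \tr (S / T) - \tr S * \tr T) =
    2 * (a * \tr (S / T) + b * \tr T) - \tr T * (a * \tr S + 2 * b) by ring.
  by rewrite trLT; ring.
transitivity ((a * \tr S + 2 * b) ^+ 2
    - 4 * (a ^+ 2 + a * b * \tr S + b ^+ 2)); last by ring.
by rewrite dLE mulr1.
Qed.

(** The quaternion relations hold for [S] and [T], so every commutator in the word is [-1]. This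
    serves to exclude [k = 0]. *)
Lemma traceless_longitude p S T : \det S = 1 -> \det T = 1 ->
    \tr S = 0 -> \tr T = 0 -> \tr (S / T) = 0 ->
  \tr (longitude p S T) ^+ 2 = 4.
Proof.
move=> dS dT trS trT trST; have [uS uT] := (unitmx_det1 dS, unitmx_det1 dT).
have iS : S^-1 = - S by rewrite invmx_det1 // trS raddf0 sub0r.
have iT : T^-1 = - T by rewrite invmx_det1 // trT raddf0 sub0r.
have SS : S * S = -1 by apply: oppr_inj; rewrite opprK -mulrN -iS divrr.
have TT : T * T = -1 by apply: oppr_inj; rewrite opprK -mulrN -iT divrr.
(* [S / T] has trace 0 too, so its inverse is its negative, which amounts to anticommutation. *)
have TS : T * S = - (S * T).
  have : (S / T)^-1 = - (S / T).
    by rewrite invmx_det1 ?trST ?raddf0 ?sub0r // detMr det_inv_det1 // dS mulr1.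
  by rewrite invrM ?unitrV // invrK iS iT !mulrN opprK => <-; rewrite opprK.
have comN (A B : 'M[F]_2) : A * A = -1 -> B * B = -1 -> B * A = - (A * B) ->
    A * B * A * B = -1.
  by move=> AA BB BA; rewrite -(mulrA A B A) BA mulrN mulrA AA mulN1r opprK BB.
have cST : commutator S T = -1.
  by rewrite /commutator iS iT !(mulrN, mulNr) opprK comN.
have cTS : commutator T S = -1.
  by rewrite /commutator iS iT !(mulrN, mulNr) opprK comN // TS opprK.
have cSV : commutator S^-1 T^-1 = -1.
  by rewrite /commutator !invrK iS iT !(mulrN, mulNr) opprK comN.
have cTV : commutator S T^-1 = -1.
  by rewrite /commutator !invrK iS iT !(mulrN, mulNr) opprK comN.
have sgn (n : nat) : (-1 : 'M[F]_2) ^+ n = 1 \/ (-1 : 'M[F]_2) ^+ n = -1.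
  by rewrite -signr_odd; case: (odd n); [right|left]; rewrite ?expr0 ?expr1.
have L2 : longitude p S T = 1 \/ longitude p S T = -1.
  rewrite /longitude; case: ifP => _.
    rewrite cST cTV; case: (sgn (p.+1)./2) => ->; left.
      by rewrite mulr1.
    by rewrite mulN1r opprK.
  rewrite cTS cSV; left; have -> : T * S * T = S.
    by rewrite TS mulNr -mulrA TT mulrN1 opprK.
  by case: (sgn p./2) => ->; rewrite ?(mulr1, mulrN1, mulNr) ?opprK mulVr.
by case: L2 => ->; rewrite ?raddfN /= ?mxtrace1 ?sqrrN -natrX.
Qed.

Lemma longitude_trace_relation p S T : \det S = 1 -> \det T = 1 ->
    \tr S ^+ 2 != 4 -> \tr T ^+ 2 != 4 ->
    S * longitude p S T = longitude p S T * S ->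
    T * longitude p T S = longitude p T S * T ->
    \tr (longitude p S T) ^+ 2 != 4 -> \tr (longitude p T S) ^+ 2 != 4 ->
  [/\ \tr S != 0, \tr T != 0 &
    (\tr (longitude p S T) + 2) * (\tr (longitude p T S) - 2) *
      (\tr S ^+ 2 * (\tr T ^+ 2 - 4)) =
    (\tr (longitude p T S) + 2) * (\tr (longitude p S T) - 2) *
      (\tr T ^+ 2 * (\tr S ^+ 2 - 4))].
Proof.
move=> dS dT trS trT comS comT loxS loxT.
(* [T / S] is the inverse of [S / T], so both slopes involve the same [k]. *)
have qE : \tr (T / S) = \tr (S / T).
  rewrite -(mxtrace_inv_det1 (A := S / T)).
    by rewrite invrM ?unitrV ?unitmx_det1 // invrK.
  by rewrite detMr det_inv_det1 // dS mulr1.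
have [a aE a2E] := longitude_slope dS dT trS comS.
have [b] := longitude_slope dT dS trT comT.
rewrite qE => bE b2E.
set x := \tr S in trS aE a2E bE b2E *; set y := \tr T in trT aE a2E bE b2E *.
set q := \tr (S / T) in qE aE bE; set k := 2 * q - x * y in aE.
rewrite [y * x]mulrC -/k in bE.
set t := \tr (longitude p S T) in loxS aE a2E *.
set u := \tr (longitude p T S) in loxT bE b2E *.
have t2 : t - 2 != 0.
  by apply: contraNneq loxS => /eqP; rewrite subr_eq0 => /eqP ->; rewrite -natrX.
have u2 : u - 2 != 0.
  by apply: contraNneq loxT => /eqP; rewrite subr_eq0 => /eqP ->; rewrite -natrX.
have k0 : k != 0.
  apply: contraNneq loxS => k0; apply/eqP.
  have y0 : y = 0.
    move/eqP: aE; rewrite k0 mulr0 eq_sym mulf_eq0 -[2 - t]opprB oppr_eq0.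
    by rewrite (negPf t2) orbF => /eqP.
  have x0 : x = 0.
    move/eqP: bE; rewrite k0 mulr0 eq_sym mulf_eq0 -[2 - u]opprB oppr_eq0.
    by rewrite (negPf u2) orbF => /eqP.
  apply: traceless_longitude => //; apply/eqP; move/eqP: k0.
  by rewrite /k y0 mulr0 subr0 mulf_eq0 pnatr_eq0.
(* If [x = 0], then [b * k = 0] forces [b = 0], and then [u ^+ 2 = 4]. *)
have x0 : x != 0.
  apply: contraNneq loxT => x0; rewrite -subr_eq0 b2E.
  by move/eqP: bE; rewrite x0 mul0r mulf_eq0 (negPf k0) orbF => /eqP ->;
    rewrite expr0n mul0r.
have y0 : y != 0.
  apply: contraNneq loxS => y0; rewrite -subr_eq0 a2E.
  by move/eqP: aE; rewrite y0 mul0r mulf_eq0 (negPf k0) orbF => /eqP ->;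
    rewrite expr0n mul0r.
split=> //.
(* Squaring the slope equation yields a factor [(t - 2)^2], of which one [t - 2] cancels against
   [t^2 - 4]. *)
have tE : k ^+ 2 * (t + 2) = y ^+ 2 * (x ^+ 2 - 4) * (t - 2).
  apply: (mulIf t2); transitivity (k ^+ 2 * (t ^+ 2 - 4)); first by ring.
  by rewrite a2E mulrA -exprMn [k * a]mulrC aE; ring.
have uE : k ^+ 2 * (u + 2) = x ^+ 2 * (y ^+ 2 - 4) * (u - 2).
  apply: (mulIf u2); transitivity (k ^+ 2 * (u ^+ 2 - 4)); first by ring.
  by rewrite b2E mulrA -exprMn [k * b]mulrC bE; ring.
apply: (mulfI (expf_neq0 2 k0)).
transitivity ((k ^+ 2 * (t + 2)) * ((u - 2) * (x ^+ 2 * (y ^+ 2 - 4)))).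
  by ring.
rewrite tE; transitivity ((x ^+ 2 * (y ^+ 2 - 4) * (u - 2)) *
  ((t - 2) * (y ^+ 2 * (x ^+ 2 - 4)))); first by ring.
by rewrite -uE; ring.
Qed.

End Matrix2.

(* The Tangent Rule squared, with [v / D] and [w / E] in the roles of
   [tanh (gamma_alpha / 4)] and [tanh (gamma_beta / 4)]. *)
Lemma sqr_tan_rule (F : fieldType) (t u D E v w x y : F) :
    t - 2 != 0 -> u - 2 != 0 ->
    (t + 2) * D ^+ 2 = (t - 2) * v ^+ 2 -> (u + 2) * E ^+ 2 = (u - 2) * w ^+ 2 ->
    (t + 2) * (u - 2) * (x ^+ 2 * (y ^+ 2 - 4)) =
      (u + 2) * (t - 2) * (y ^+ 2 * (x ^+ 2 - 4)) ->
  E ^+ 2 * (x ^+ 2 * (4 - y ^+ 2)) * v ^+ 2 =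
    D ^+ 2 * (y ^+ 2 * (4 - x ^+ 2)) * w ^+ 2.
Proof.
move=> t2 u2 tE uE rel; apply: (mulfI (mulf_neq0 t2 u2)).
transitivity ((t - 2) * v ^+ 2 * (u - 2) * E ^+ 2 * (x ^+ 2 * (4 - y ^+ 2))).
  by ring.
rewrite -tE; transitivity (- ((t + 2) * (u - 2) * (x ^+ 2 * (y ^+ 2 - 4)))
  * D ^+ 2 * E ^+ 2); first by ring.
rewrite rel; transitivity ((u + 2) * E ^+ 2 * (t - 2) * D ^+ 2 *
  (y ^+ 2 * (4 - x ^+ 2))); first by ring.
by rewrite uE; ring.
Qed.

(** * Hyperbolic half-angle identities and comparison of arguments *)

Section Real.
Variable R : realType.
Implicit Types (r phi x y : R).

Definition coshR x : R := (expR x + expR (- x)) / 2.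

Lemma coshR2 x : coshR x ^+ 2 = 1 + sinhR x ^+ 2.
Proof.
rewrite /coshR /sinhR; have e1 : expR x * expR (- x) = 1 by rewrite expRxMexpNx_1.
by transitivity (expR x * expR (- x) + ((expR x - expR (- x)) / 2) ^+ 2);
  [field | rewrite e1].
Qed.

Lemma sinhR_gt0 x : 0 < x -> 0 < sinhR x.
Proof. by move=> x0; rewrite divr_gt0 // subr_gt0 ltr_expR gtrN. Qed.

Lemma coshR_gt1 x : 0 < x -> 1 < coshR x.
Proof.
move=> x0; have c0 : 0 < coshR x by rewrite divr_gt0 // addr_gt0 ?expR_gt0.
rewrite -(ltr_pXn2r (n := 2)) ?nnegrE ?ltW // expr1n coshR2.
by rewrite ltrDl exprn_gt0 // sinhR_gt0.
Qed.

Lemma ccosh_half r phi : ccosh ((r +i* phi) / 2) =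
  (coshR (r / 2) * cos (phi / 2)) +i* (sinhR (r / 2) * sin (phi / 2)).
Proof.
have halfE (a b : R) : (a +i* b) / 2 = (a / 2) +i* (b / 2).
  have two : (2 : R[i]) = 2%:C by rewrite rmorph_nat.
  have : (2 : R[i]) != 0 by rewrite pnatr_eq0.
  move=> n2; apply: (mulIf n2); rewrite divfK // two.
  by apply/eqP; rewrite eq_complex /= !mulr0 subr0 add0r !divfK ?pnatr_eq0 ?eqxx.
rewrite /ccosh halfE /cexp /= cosN sinN.
have -> (a b c d e : R) : a%:C * (c +i* d) + b%:C * (c +i* e) =
    ((a + b) * c) +i* (a * d + b * e).
  apply/eqP; rewrite eq_complex /=; apply/andP; split; apply/eqP; ring.
rewrite halfE /coshR /sinhR; apply/eqP; rewrite eq_complex /=.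
by apply/andP; split; apply/eqP; field.
Qed.

(* [tanh(g/2) = (sinh h + i sin u) / (cosh h + cos u)] for [g = h + i u], squared. *)
Lemma tanh_half_sqr (ch sh c s : R) : ch ^+ 2 = 1 + sh ^+ 2 ->
    c ^+ 2 + s ^+ 2 = 1 ->
  ((ch * c) +i* (sh * s) - 1) * (ch + c)%:C ^+ 2 =
  ((ch * c) +i* (sh * s) + 1) * (sh +i* s) ^+ 2.
Proof.
move=> chE cE; have sE : s ^+ 2 = 1 - c ^+ 2 by rewrite -cE addrAC subrr add0r.
apply/eqP; rewrite eq_complex; apply/andP; split; apply/eqP => /=; ring: chE sE.
Qed.

(** The quotient of the two complex numbers has a positive square, so it is real and both lie on one
    line through 0. *)
Lemma sqr_ratio_arg (a b c d k l : R) : 0 < a -> 0 < c -> 0 < k -> 0 < l ->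
  k%:C * (a +i* b) ^+ 2 = l%:C * (c +i* d) ^+ 2 -> b / a = d / c.
Proof.
move=> a0 c0 k0 l0 /eqP; rewrite eq_complex /= => /andP[/eqP eR /eqP eI].
have eRe : k * (a ^+ 2 - b ^+ 2) = l * (c ^+ 2 - d ^+ 2).
  by transitivity (k * (a * a - b * b) - 0 * (a * b + b * a));
    [ring | rewrite eR; ring].
have eIm : k * (a * b) = l * (c * d).
  apply: (mulIf (_ : 2 != 0 :> R)); first by rewrite pnatr_eq0.
  by transitivity (k * (a * b + b * a) + 0 * (a * a - b * b));
    [ring | rewrite eI; ring].
(* The left side is half the imaginary part of [((a + i b) (c - i d))^2]. *)
have : (b * c - d * a) * (a * c + b * d) = 0.
  apply: (mulfI (lt0r_neq0 (mulr_gt0 k0 l0))); rewrite mulr0.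
  transitivity (k * (a * b) * (l * (c ^+ 2 - d ^+ 2))
    - (l * (c * d)) * (k * (a ^+ 2 - b ^+ 2))); first by ring.
  by rewrite -eRe eIm subrr.
move=> /eqP; rewrite mulf_eq0 subr_eq0 => /orP[/eqP bc | /eqP bd].
  by apply/eqP; rewrite eqr_div ?lt0r_neq0 // bc.
(* Perpendicular numbers have squares of opposite direction: here [k (a b)^2] would equal
   [- l (a c)^2 < 0]. *)
have ac0 : 0 < a * c by rewrite mulr_gt0.
have : 0 <= k * a ^+ 2 * b ^+ 2 by rewrite mulr_ge0 ?sqr_ge0 // mulr_ge0 ?sqr_ge0 // ltW.
have -> : k * a ^+ 2 * b ^+ 2 = k * (a * b) * (a * b) by ring.
rewrite eIm; have -> : l * (c * d) * (a * b) = l * (a * c) * (b * d) by ring.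
have -> : b * d = - (a * c) by apply/eqP; rewrite -addr_eq0 addrC bd.
by rewrite mulrN oppr_ge0 leNgt !mulr_gt0.
Qed.

(** As [tr L = -2 cosh (gamma / 2)], the quotient [(tr L + 2) / (tr L - 2)] is [tanh^2 (gamma / 4)];
    the equation is this with denominators cleared. *)
Lemma complex_length_trace (L : 'M[R[i]]_2) r phi : complex_length L r phi ->
  [/\ \tr L ^+ 2 != 4, 0 < coshR (r / 2) + cos (phi / 2) &
    (\tr L + 2) * (coshR (r / 2) + cos (phi / 2))%:C ^+ 2 =
    (\tr L - 2) * (sinhR (r / 2) +i* sin (phi / 2)) ^+ 2].
Proof.
case=> _ r0; rewrite ccosh_half => trE.
have h0 : 0 < r / 2 by rewrite divr_gt0.
have ch1 := coshR_gt1 h0; have sh0 := sinhR_gt0 h0.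
have tE : \tr L = - 2 * ((coshR (r / 2) * cos (phi / 2)) +i*
                         (sinhR (r / 2) * sin (phi / 2))).
  by rewrite trE mulrN mulNr opprK mulrC divfK // pnatr_eq0.
have := tanh_half_sqr (coshR2 (r / 2)) (cos2Dsin2 (phi / 2)).
move: tE; set z : R[i] := (_ * _) +i* _ => -> zE.
have D0 : 0 < coshR (r / 2) + cos (phi / 2).
  by have := cos_geN1 (phi / 2); lra.
split=> //; last first.
  transitivity (- 2 * ((z - 1) * (coshR (r / 2) + cos (phi / 2))%:C ^+ 2)).
    by ring.
  by rewrite zE; ring.
(* By [zE], the value [z = 1] would make [sinhR (r / 2)] vanish, and [z = -1] would make
   [coshR (r / 2) + cos (phi / 2)] vanish. *)
apply/negP => /eqP z2; have {}z2 : z ^+ 2 = 1.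
  apply: (mulfI (_ : 4 != 0 :> R[i])); first by rewrite pnatr_eq0.
  by transitivity ((- 2 * z) ^+ 2); [ring | rewrite z2 mulr1].
have := eqf_sqr z 1; rewrite z2 expr1n eqxx => /esym/orP[]/eqP z1; move: zE.
  rewrite z1 subrr mul0r => /esym/eqP.
  rewrite mulf_eq0 -mulr2n pnatr_eq0 /= expf_eq0 eq_complex /=.
  by rewrite gt_eqF.
rewrite z1 addNr mul0r => /eqP.
rewrite mulf_eq0 -opprD oppr_eq0 -mulr2n pnatr_eq0 /= expf_eq0 eq_complex /=.
by rewrite gt_eqF.
Qed.

End Real.

Theorem theorem9 (R : realType) (p : nat) (alpha beta : R)
  (halpha : 0 < alpha <= pi) (hbeta : 0 < beta <= pi)
  (S T : 'M[R[i]]_2) (hol : cone_holonomy p alpha beta S T)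
  (ra phia rb phib : R)
  (hgamma_alpha : complex_length (longitude p S T) ra phia)
  (hgamma_beta : complex_length (longitude p T S) rb phib) :
  sin (phia / 2) / sinhR (ra / 2) = sin (phib / 2) / sinhR (rb / 2).
Proof.
case: hol => dS dT comS comT trS trT.
have [loxS DS0 tanS] := complex_length_trace hgamma_alpha.
have [loxT DT0 tanT] := complex_length_trace hgamma_beta.
have sh0 r phi L : @complex_length R L r phi -> 0 < sinhR (r / 2).
  by case=> _ r0 _; rewrite sinhR_gt0 // divr_gt0.
(* Meridians are elliptic: half a cone angle lies strictly between [0] and [pi], so its sine is
   positive. *)
have sin0 (theta : R) : 0 < theta <= pi -> 0 < 4 - (2 * cos (theta / 2)) ^+ 2.
  move=> /andP[t0 tpi]; have -> : 4 - (2 * cos (theta / 2)) ^+ 2 =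
      4 * sin (theta / 2) ^+ 2 by rewrite sin2cos2; ring.
  rewrite mulr_gt0 // exprn_gt0 // sin_gt0_pi // divr_gt0 //=.
  by have := pi_gt0 R; lra.
move: (sin0 _ halpha) (sin0 _ hbeta) trS trT.
set x := 2 * cos (alpha / 2); set y := 2 * cos (beta / 2) => x4 y4 trS trT.
have complex4 (z : R) : (4 - z ^+ 2)%:C = 4 - z%:C ^+ 2 :> R[i].
  by rewrite rmorphB rmorphXn rmorph_nat.
have ell (z : R) : 0 < 4 - z ^+ 2 -> z%:C ^+ 2 != 4 :> R[i].
  move=> z4; rewrite -subr_eq0 -oppr_eq0 opprB -complex4.
  by rewrite eq_complex /= gt_eqF.
have := @longitude_trace_relation _ p _ _ dS dT.
rewrite trS trT => /(_ (ell _ x4) (ell _ y4) comS comT loxS loxT).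
rewrite !eq_complex /= eqxx !andbT => -[x0 y0 rel].
(* The weights are the real factors on the two sides of [sqr_tan_rule]. *)
apply: (@sqr_ratio_arg _ _ _ _ _
  ((coshR (rb / 2) + cos (phib / 2)) ^+ 2 * (x ^+ 2 * (4 - y ^+ 2)))
  ((coshR (ra / 2) + cos (phia / 2)) ^+ 2 * (y ^+ 2 * (4 - x ^+ 2)))).
- exact: sh0 hgamma_alpha.
- exact: sh0 hgamma_beta.
(* Strict positivity rests on [x0] here and on [y0] for the second weight. *)
- by rewrite mulr_gt0 ?exprn_gt0 // mulr_gt0 // exprn_even_gt0.
- by rewrite mulr_gt0 ?exprn_gt0 // mulr_gt0 // exprn_even_gt0.
have kE (d a b : R) : (d ^+ 2 * (a ^+ 2 * (4 - b ^+ 2)))%:C =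
    d%:C ^+ 2 * (a%:C ^+ 2 * (4 - b%:C ^+ 2)) :> R[i].
  by rewrite -complex4 -!rmorphXn -!rmorphM.
rewrite !kE.
have neq2 (L : 'M[R[i]]_2) : \tr L ^+ 2 != 4 -> \tr L - 2 != 0.
  by apply: contraNneq => /eqP; rewrite subr_eq0 => /eqP ->; rewrite -natrX.
exact: (sqr_tan_rule (neq2 _ loxS) (neq2 _ loxT) tanS tanT rel).
Qed.
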